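(* Let $v$ be a vertex with vertex-constraint $b_v$ and adjacent edges with constraints $(c_e)$, let $\overrightarrow e$ be a directed edge outgoing from $v$, and let $\lambda>0$. (1) The operator $\mathcal R^{(\lambda)}_{\overrightarrow e}:\widetilde{\mathcal P}^{\partial\overrightarrow e}\to\widetilde{\mathcal P}$ is non-increasing for the $\mathrm{lr}\uparrow$-order: if $\mathbf m^1\le_{\mathrm{lr}\uparrow}\mathbf m^2$ componentwise, then $\mathcal R^{(\lambda)}_{\overrightarrow e}[\mathbf m^2]\le_{\mathrm{lr}\uparrow}\mathcal R^{(\lambda)}_{\overrightarrow e}[\mathbf m^1]$. Furthermore, if all the inputs of $\mathcal R^{(\lambda)}_{\overrightarrow e}$ are log-concave, then the output is also log-concave. (2) The operator $\mathcal D_v:\widetilde{\mathcal P}^{\overrightarrow{\partial v}}\to\mathbb R^+$ is non-decreasing: if $\mathbf m^1\le_{\mathrm{lr}\uparrow}\mathbf m^2$ componentwise, then $\mathcal D_v[\mathbf m^1]\le\mathcal D_v[\mathbf m^2]$. It is strictly increasing if all its inputs are log-concave with $0$ in their support: if moreover all components of $\mathbf m^1,\mathbf m^2$ are log-concave with $0$ in their support and $\mathbf m^1\neq\mathbf m^2$, then $\mathcal D_v[\mathbf m^1]<\mathcal D_v[\mathbf m^2]$.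
   Context: $\mathbb N=\{0,1,\dots\}$. $\mathcal P$ is the set of probability distributions on $\mathbb N$ with bounded support; $\widetilde{\mathcal P}\subset\mathcal P$ is the set of those whose support is an interval of integers containing $0$. For $m,m'\in\mathcal P$, $m\le_{\mathrm{lr}\uparrow}m'$ (upshifted likelihood-ratio order) means $m(i+j+s)\,m'(i)\le m(i+s)\,m'(i+j)$ for all $i,j,s\in\mathbb N$. A distribution $p$ is log-concave if its support is an interval and $p(i)p(i+2)\le p(i+1)^2$ for all $i\in\mathbb N$. In a graph with integer vertex-constraints $b_v\ge0$ and edge-constraints $c_e\ge0$, $\overrightarrow{\partial v}$ is the set of edges directed towards $v$; for a directed edge $\overrightarrow e=\overrightarrow{vu}$ outgoing from $v$, $\partial\overrightarrow e=\{\overrightarrow{wv}: w\sim v,\ w\ne u\}$ and $c_e=c_{vu}$. For a finite index set $S$, $\mathbf m_S(\mathbf y)=\prod_{i\in S}m_i(y_i)$ and $|\mathbf y|=\sum_{i\in S}y_i$ for $\mathbf y\in\mathbb N^S$; sums over $\mathbf y$ run over $\mathbb N^S$ subject to the indicated constraint. The operators are $$\mathcal R^{(\lambda)}_{\overrightarrow e}[\mathbf m](x)=\frac{\lambda^x\mathbf 1(x\le c_e)\sum_{|\mathbf y|\le b_v-x}\mathbf m_{\partial\overrightarrow e}(\mathbf y)}{\sum_{0\le t\le c_e}\lambda^t\sum_{|\mathbf y|\le b_v-t}\mathbf m_{\partial\overrightarrow e}(\mathbf y)},\qquad \mathcal D_v[\mathbf m]=\frac{\sum_{|\mathbf x|\le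 b_v}|\mathbf x|\,\mathbf m_{\overrightarrow{\partial v}}(\mathbf x)}{\sum_{|\mathbf x|\le b_v}\mathbf m_{\overrightarrow{\partial v}}(\mathbf x)}.$$
   Formalization: In the strict-increase clause of (2), the condition m^1≠m^2 is replaced by: for some edge the laws conditioned on {0,…,b_v} differ; with only m^1≠m^2 the claim fails (e.g. b_v=0, where D_v is identically 0). *)

(* Defs.v *)
From HB Require Import structures.
From mathcomp Require Import all_boot all_order all_algebra.
From mathcomp Require Import reals.

Set Implicit Arguments.
Unset Strict Implicit.
Unset Printing Implicit Defensive.
Import Order.TTheory GRing.Theory Num.Theory.
Local Open Scope ring_scope.

(* Simple graphs, finite or infinite but locally finite. *)
Record graph := Graph {
  vertex :> choiceType;
  nbr : vertex -> seq vertex;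
  nbr_sym : forall u v, (u \in nbr v) = (v \in nbr u);
  nbr_irr : forall v, v \notin nbr v }.

(* The pair (w, v) is the edge from w to v. *)
Definition in_edges (G : graph) (v : G) : seq (G * G) :=
  [seq (w, v) | w <- nbr v].

Definition prev_edges (G : graph) (e : G * G) : seq (G * G) :=
  [seq (w, e.1) | w <- nbr e.1 & w != e.2].

(* Distributions on the natural numbers are given by their mass functions. *)
Section Distributions.
Variable R : realType.
Implicit Types p q : nat -> R.

Definition is_distr p : Prop :=
  (forall i, 0 <= p i) /\
  (exists n, (forall i, (n <= i)%N -> p i = 0) /\ \sum_(i < n) p i = 1).

Definition interval_support p : Prop :=
  forall i k j, (i <= k <= j)%N -> p i != 0 -> p j != 0 -> p k != 0.

Definition Ptilde p : Prop :=
  [/\ is_distr p, interval_support p & p 0%N != 0].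

Definition lr_up p q : Prop :=
  forall i j s : nat, p (i + j + s)%N * q i <= p (i + s)%N * q (i + j)%N.

Definition log_concave p : Prop :=
  interval_support p /\ forall i, p i * p i.+2 <= p i.+1 ^+ 2.

(* The law of X given X <= n, for X of law p. *)
Definition cond_le (n : nat) p : nat -> R :=
  fun x => (x <= n)%N%:R * p x / (\sum_(t < n.+1) p t).

Lemma cond_le_id n p :
  is_distr p -> (forall x, (n < x)%N -> p x = 0) -> cond_le n p =1 p.
Proof.
move=> [_ [k [pk sum1]]] pn x; rewrite /cond_le.
have big0 l a : (forall i, (a <= i)%N -> p i = 0) ->
    \sum_(i < a + l) p i = \sum_(i < a) p i.
  move=> pa; elim: l => [|l IH]; first by rewrite addn0.
  by rewrite addnS big_ord_recr /= IH pa ?addr0 ?leq_addr.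
have -> : \sum_(t < n.+1) p t = 1.
  by rewrite -(big0 k n.+1 pn) addnC big0.
rewrite divr1; case: leqP => [_|/pn ->]; first by rewrite mul1r.
by rewrite mulr0.
Qed.

End Distributions.

Section Operators.
Variables (R : realType) (S : finType).
Implicit Types m : S -> nat -> R.

(* The sum of m_S(y) over |y| <= b - x, which is empty when b < x: hence the
   condition |y| + x <= b rather than a truncated subtraction. Coordinates are
   bounded by b to keep the index type finite; the constraint implies it. *)
Definition constrained_sum m (b x : nat) : R :=
  \sum_(y : {ffun S -> 'I_b.+1} | ((\sum_i y i) + x <= b)%N)
    \prod_i m i (y i).

Definition R_op (lam : R) (b c : nat) m : nat -> R := fun x =>
  lam ^+ x * (x <= c)%N%:R * constrained_sum m b x /
  (\sum_(t < c.+1) lam ^+ t * constrained_sum m b t).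

Definition D_op (b : nat) m : R :=
  (\sum_(x : {ffun S -> 'I_b.+1} | (\sum_i x i <= b)%N)
     (\sum_i x i)%N%:R * \prod_i m i (x i)) /
  (\sum_(x : {ffun S -> 'I_b.+1} | (\sum_i x i <= b)%N) \prod_i m i (x i)).

End Operators.

Section GraphOperators.
Variables (R : realType) (G : graph) (b : G -> nat) (c : G -> G -> nat).

Definition R_edge (lam : R) (e : G * G)
    (m : seq_sub (prev_edges e) -> nat -> R) : nat -> R :=
  R_op lam (b e.1) (c e.1 e.2) m.

Definition D_vertex (v : G) (m : seq_sub (in_edges v) -> nat -> R) : R :=
  D_op (b v) m.

End GraphOperators.

(* Main.v *)
Require Import Defs.
From HB Require Import structures.
From mathcomp Require Import all_boot all_order all_algebra.
From mathcomp Require Import reals.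
From mathcomp Require Import zify.

Set Implicit Arguments.
Unset Strict Implicit.
Unset Printing Implicit Defensive.
Import Order.TTheory GRing.Theory Num.Theory.
Local Open Scope ring_scope.

(** The order is a statement about the product kernel [g x y = p x * q y] of a
    pair: [lr_up p q] says that, when [x >= y], moving any [j <= x - y] units
    from the first argument to the second does not decrease [g]; this is the
    predicate [transfer].  For a fixed total [x + y] it reads
    [g(d) <= g(e)] whenever [|e| <= d], with [d] the difference of the two
    arguments.  The kernel of two convolutions is the convolution of the
    kernels, so everything rests on one fact, [conv_transfer]: [transfer]
    kernels are closed under two-dimensional convolution.  Its proof splits one
    factor into a symmetric kernel, for which the classical reflection argument
    for symmetric unimodal sequences works, and a remainder supported on
    negative differences, for which the inequality holds term by term.

    The mass function of the total [|y|] of independent inputs is the coefficient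
    sequence of the product of their generating polynomials.  Only totals at most
    [b] matter, so the inputs may be truncated at [b], which preserves the order.
    By [lr_up_mul], the totals of two ordered families are then ordered.

    For R_op, the constrained sum at [x] is a cumulative sum, up to [b - x], of
    the law of the total.  A cumulative sum is one more convolution, with a
    constant sequence, which is below itself; the reversal [x -> b - x] turns the
    order around, and the factor [lam ^+ x] cancels because both sides of the
    inequality have the same total exponent.  Log-concavity comes for free: for
    nonnegative mass functions with interval support it is the same as
    [lr_up p p], so it is the monotonicity statement applied to a family compared
    with itself.

    For D_op, the usual likelihood ratio order between the totals makes their
    conditional means ordered, by a Chebyshev pairing of [(k, l)] with [(l, k)].
    If the means coincide, every pair contributes zero, and the two laws are
    proportional up to [b].  For strictness it suffices to change one input on
    which the two families differ: log-concavity makes the order reflexive, so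
    the mixed family sits between the two.  The other inputs contribute a common
    polynomial factor with nonzero constant term, hence invertible modulo
    ['X^b.+1], and cancelling it would make the two versions of the changed input
    proportional up to [b]. *)

(** * Pairing each index pair with its mirror image *)


(** Adding to the difference of the two sums its own mirror image factors each
    summand; the doubling avoids dividing by two. *)
Lemma swap_gap (R : comPzRingType) M (H K : nat -> nat -> R) :
  (\sum_(a < M) \sum_(c < M) H a c * K c a
     - \sum_(a < M) \sum_(c < M) H a c * K a c) *+ 2
  = \sum_(a < M) \sum_(c < M) (H c a - H a c) * (K a c - K c a).
Proof.
have tr (F : nat -> nat -> R) :
    \sum_(a < M) \sum_(c < M) F c a = \sum_(a < M) \sum_(c < M) F a c.
  by rewrite exchange_big.
rewrite mulr2n.
rewrite -{1}(tr (fun a c => H a c * K c a)) -{1}(tr (fun a c => H a c * K a c)).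
rewrite -!sumrB -big_split /=; apply: eq_bigr => a _ /=.
rewrite -!sumrB -big_split /=; apply: eq_bigr => c _.
rewrite mulrBl !mulrBr opprB addrA; congr (_ + _).
Qed.

Lemma swap_gap_ge0 (R : numDomainType) (H K : nat -> nat -> R) (a c : nat) :
  (forall x y, (y <= x)%N -> H x y <= H y x) ->
  (forall x y, (y <= x)%N -> K y x <= K x y) ->
  0 <= (H c a - H a c) * (K a c - K c a).
Proof.
move=> leH leK; have [/ltnW ac|ca] := ltnP a c.
  by rewrite mulr_le0 ?subr_le0 ?leH ?leK.
by rewrite mulr_ge0 ?subr_ge0 ?leH ?leK.
Qed.

Lemma swap_le (R : numDomainType) M (H K : nat -> nat -> R) :
  (forall x y, (y <= x)%N -> H x y <= H y x) ->
  (forall x y, (y <= x)%N -> K y x <= K x y) ->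
  \sum_(a < M) \sum_(c < M) H a c * K a c
    <= \sum_(a < M) \sum_(c < M) H a c * K c a.
Proof.
move=> leH leK; rewrite -subr_ge0 -(pmulrn_lge0 _ (ltn0Sn 1)) swap_gap.
by apply: sumr_ge0 => a _; apply: sumr_ge0 => c _; apply: swap_gap_ge0.
Qed.

(** All terms of [swap_gap] are nonnegative, so one nonzero term suffices. *)
Lemma swap_lt (R : numDomainType) M (H K : nat -> nat -> R) (a c : 'I_M) :
  (forall x y, (y <= x)%N -> H x y <= H y x) ->
  (forall x y, (y <= x)%N -> K y x <= K x y) ->
  H c a != H a c -> K a c != K c a ->
  \sum_(a < M) \sum_(c < M) H a c * K a c
    < \sum_(a < M) \sum_(c < M) H a c * K c a.
Proof.
move=> leH leK neH neK; rewrite -subr_gt0 -(pmulrn_lgt0 _ (ltn0Sn 1)) swap_gap.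
have row_ge0 (x : 'I_M) (P : pred 'I_M) :
    0 <= \sum_(y < M | P y) (H y x - H x y) * (K x y - K y x).
  by apply: sumr_ge0 => y _; apply: swap_gap_ge0.
rewrite (bigD1 a) //= ltr_wpDr //; first by apply: sumr_ge0 => x _.
rewrite (bigD1 c) //= ltr_wpDr // lt_neqAle eq_sym mulf_eq0 !subr_eq0.
by rewrite negb_or neH neK swap_gap_ge0.
Qed.

(** * Closure of transfer kernels under convolution *)

Section Kernels.
Variable R : numDomainType.
Implicit Types (g h : nat -> nat -> R).

(** [lr_up p q] unfolds to [transfer (fun x y => p x * q y)]. *)
Definition transfer g : Prop :=
  forall i j s : nat, g (i + j + s)%N i <= g (i + s)%N (i + j)%N.

Definition conv g h (x y : nat) : R :=
  \sum_(a < x.+1) \sum_(c < y.+1) g a c * h (x - a)%N (y - c)%N.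

Lemma conv_rev g h x y :
  conv g h x y =
  \sum_(a < x.+1) \sum_(c < y.+1) g (x - a)%N (y - c)%N * h a c.
Proof.
rewrite /conv (reindex_inj rev_ord_inj); apply: eq_bigr => a _ /=.
rewrite (reindex_inj rev_ord_inj); apply: eq_bigr => c _ /=.
by rewrite !subSS !subKn // -ltnS.
Qed.

Lemma sum_widen (F : nat -> R) (m M : nat) : (m <= M)%N ->
  \sum_(c < m) F c = \sum_(c < M) (if (c < m)%N then F c else 0).
Proof. by move=> mM; rewrite -big_mkcond (big_ord_widen M F). Qed.

Lemma sum_shift (F : nat -> R) (m s : nat) :
  \sum_(c < m) F c = \sum_(c < s + m) (if (s <= c)%N then F (c - s)%N else 0).
Proof.
rewrite [RHS]big_split_ord /= [X in _ = X + _]big1 => [|c _]; last first.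
  by rewrite leqNgt ltn_ord.
by rewrite add0r; apply: eq_bigr => c _; rewrite leq_addr addKn.
Qed.

(** Shifting the second coordinate of [g] by [s] centres the reflection: the
    mirror image of [(a, c)] becomes [(c, a)], and by the symmetry of [h] the two
    sides of the inequality are the two sums compared by [swap_le]. *)
Lemma conv_transfer_sym g h :
  (forall x y, 0 <= g x y) -> (forall x y, 0 <= h x y) ->
  transfer g -> transfer h -> (forall x y, h x y = h y x) ->
  transfer (conv g h).
Proof.
move=> g0 h0 tg th hC i j s.
set n := (i + s)%N; set M := (n + j).+1.
(* [H] and [K] are the two factors extended by zero to a square of indices. *)
pose H a c := if (s <= c)%N then g a (c - s)%N else 0.
pose K a c := if (a < M)%N && (c <= n)%N then h (n + j - a)%N (n - c)%N else 0.
have -> : conv g h (i + j + s) i = \sum_(a < M) \sum_(c < M) H a c * K a c.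
  rewrite /conv; have -> : (i + j + s)%N = (n + j)%N by lia.
  apply: eq_bigr => a _ /=.
  rewrite (sum_shift (fun c => g a c * h (n + j - a)%N (i - c)%N) _ s).
  rewrite (@sum_widen (fun c => if (s <= c)%N
             then g a (c - s)%N * h (n + j - a)%N (i - (c - s))%N else 0) _ M);
    last by lia.
  apply: eq_bigr => c _; rewrite /H /K ltn_ord addnS ltnS addnC.
  rewrite -/n; case: leqP => cn; last by rewrite mulr0.
  case: leqP => sc; last by rewrite mul0r.
  by congr (_ * h _ _); lia.
have -> : conv g h n (i + j) = \sum_(a < M) \sum_(c < M) H a c * K c a.
  rewrite /conv.
  rewrite (@sum_widen (fun a => \sum_(c < _) g a c * h (n - a)%N (i + j - c)%N)
             _ M); last by lia.
  apply: eq_bigr => a _; rewrite /K ltnS.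
  case: leqP => an; last by rewrite big1 // => c _; rewrite andbF mulr0.
  rewrite (sum_shift (fun c => g a c * h (n - a)%N (i + j - c)%N) _ s).
  have -> : (s + (i + j).+1)%N = M by lia.
  apply: eq_bigr => c _; rewrite /H ltn_ord.
  case: leqP => sc; last by rewrite mul0r.
  by rewrite /= [h (n + j - c)%N _]hC; congr (_ * h _ _); lia.
apply: swap_le => a c ca; rewrite /H /K.
  case: (leqP s c) => sc; last by case: ifP.
  rewrite (leq_trans sc ca).
  have := tg (c - s)%N (a - c)%N s.
  have -> : (c - s + (a - c) + s = a)%N by lia.
  have -> : (c - s + s = c)%N by lia.
  by have -> : (c - s + (a - c) = a - s)%N by lia.
case: ifP => [/andP[cM an]|_]; last by case: ifP.
have -> : (a < M)%N by lia.
have -> : (c <= n)%N by lia.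
(* The point with the larger difference is compared with the other one or with
   its mirror image, according to the sign of the other difference. *)
rewrite /=; have [ajc|ajc] := leqP (a - c) j.
  have := th (n - a)%N (a - c)%N (j - (a - c) + (a - c))%N.
  have -> : (n - a + (a - c) + (j - (a - c) + (a - c)) = n + j - c)%N by lia.
  have -> : (n - a + (j - (a - c) + (a - c)) = n + j - a)%N by lia.
  by have -> : (n - a + (a - c) = n - c)%N by lia.
rewrite [leRHS]hC.
have := th (n - a)%N j (a - c)%N.
have -> : (n - a + j + (a - c) = n + j - c)%N by lia.
have -> : (n - a + (a - c) = n - c)%N by lia.
by have -> : (n - a + j = n + j - a)%N by lia.
Qed.

(** For [y > x], subtracting [(x, y)] only increases the room for a transfer in
    [g], so the terms can be compared one by one. *)
Lemma conv_transfer_upper g h :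
  (forall x y, 0 <= g x y) -> (forall x y, 0 <= h x y) ->
  transfer g -> (forall x y, (y <= x)%N -> h x y = 0) ->
  transfer (conv g h).
Proof.
move=> g0 h0 tg hz i j s; rewrite !conv_rev.
set n := (i + s)%N; have -> : (i + j + s)%N = (n + j)%N by lia.
rewrite (@sum_widen (fun a => \sum_(c < (i + j).+1)
           g (n - a)%N (i + j - c)%N * h a c) n.+1 (n + j).+1); last by lia.
apply: ler_sum => a _.
case: ltnP => an; last first.
  rewrite big1 // => c _; rewrite hz ?mulr0 //; have := ltn_ord c; lia.
rewrite (@sum_widen (fun c => g (n + j - a)%N (i - c)%N * h a c) i.+1 (i + j).+1);
  last by lia.
apply: ler_sum => c _.
case: ltnP => ci; last by rewrite mulr_ge0.
have [ca|ac] := leqP c a; first by rewrite hz ?mulr0.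
apply: ler_wpM2r => //.
have := tg (i - c)%N j (s + (c - a))%N.
have -> : (i - c + j + (s + (c - a)) = n + j - a)%N by lia.
have -> : (i - c + (s + (c - a)) = n - a)%N by lia.
by have -> : (i - c + j = i + j - c)%N by lia.
Qed.

(** The reflection argument fails for a general [h], whose values at negative
    differences may be arbitrarily large; this excess over the symmetrization
    [hs] of the values at nonnegative differences is handled separately. *)
Lemma conv_transfer g h :
  (forall x y, 0 <= g x y) -> (forall x y, 0 <= h x y) ->
  transfer g -> transfer h -> transfer (conv g h).
Proof.
move=> g0 h0 tg th.
pose hs x y := h (maxn x y) (minn x y).
pose hu x y := h x y - hs x y.
have hs_ge x y : (y <= x)%N -> hs x y = h x y.
  by move=> yx; rewrite /hs (maxn_idPl yx) (minn_idPr yx).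
have hsC x y : hs x y = hs y x by rewrite /hs maxnC minnC.
have hu0 x y : 0 <= hu x y.
  rewrite subr_ge0; have [yx|/ltnW xy] := leqP y x; first by rewrite hs_ge.
  rewrite hsC hs_ge //; have := th x (y - x)%N 0%N.
  by rewrite !addn0 subnKC.
have convD x y : conv g h x y = conv g hs x y + conv g hu x y.
  rewrite /conv -big_split; apply: eq_bigr => a _ /=.
  rewrite -big_split; apply: eq_bigr => c _ /=.
  by rewrite -mulrDr /hu addrC subrK.
move=> i j s; rewrite !convD; apply: lerD.
  apply: conv_transfer_sym => // [x y|{}i {}j {}s]; first exact: h0.
  rewrite hs_ge ?leq_addr -?addnA ?leq_addr // addnA.
  have [js|/ltnW sj] := leqP j s; first by rewrite hs_ge ?leq_add2l.
  by rewrite hsC hs_ge ?leq_add2l // addnAC.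
apply: conv_transfer_upper => // x y yx.
by rewrite /hu hs_ge // subrr.
Qed.

End Kernels.

(** * The upshifted likelihood ratio order *)

Section LrUp.
Variable R : realType.
Implicit Types p q : nat -> R.

Lemma lr_up_mul (P1 P2 Q1 Q2 : {poly R}) :
  (forall k, 0 <= P1`_k) -> (forall k, 0 <= P2`_k) ->
  (forall k, 0 <= Q1`_k) -> (forall k, 0 <= Q2`_k) ->
  lr_up (nth 0 P1) (nth 0 Q1) -> lr_up (nth 0 P2) (nth 0 Q2) ->
  lr_up (nth 0 (P1 * P2)) (nth 0 (Q1 * Q2)).
Proof.
move=> P10 P20 Q10 Q20 l1 l2.
have convE x y : (P1 * P2)`_x * (Q1 * Q2)`_y =
    conv (fun x y => P1`_x * Q1`_y) (fun x y => P2`_x * Q2`_y) x y.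
  rewrite !coefM big_distrlr; apply: eq_bigr => a _; apply: eq_bigr => c _.
  by rewrite mulrACA.
move=> i j s; rewrite !convE.
by apply: conv_transfer => // x y; rewrite mulr_ge0.
Qed.

(** Log-concavity says that the ratios of consecutive masses decrease along the
    support; the interval support allows dividing by the intermediate masses. *)
Lemma lr_up_refl p :
  (forall i, 0 <= p i) -> log_concave p -> lr_up p p.
Proof.
move=> p0 [ip lc].
have pos i k j : (i <= k <= j)%N -> p i != 0 -> p j != 0 -> 0 < p k.
  by move=> ikj pi pj; rewrite lt_neqAle p0 eq_sym (ip _ _ _ ikj).
have step1 i s : p (i + s).+1 * p i <= p (i + s)%N * p i.+1.
  elim: s => [|s IH]; first by rewrite addn0 mulrC.
  have [z|nz] := eqVneq (p i) 0; first by rewrite z mulr0 mulr_ge0.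
  have [z|nz'] := eqVneq (p (i + s).+2) 0; first by rewrite addnS z mul0r mulr_ge0.
  have ps : 0 < p (i + s).+1 by apply: (pos i _ (i + s).+2) => //; lia.
  rewrite addnS -(ler_pM2r ps).
  apply: (@le_trans _ _ (p (i + s).+2 * (p (i + s)%N * p i.+1))).
    by rewrite -mulrA [X in _ * X <= _]mulrC ler_wpM2l.
  rewrite mulrA [X in X * _ <= _]mulrC mulrAC.
  rewrite [leRHS]mulrAC [leLHS]mulrAC.
  by rewrite ler_wpM2r // -expr2.
move=> i j s; elim: j => [|j IH]; first by rewrite !addn0.
have [z|nz] := eqVneq (p i) 0; first by rewrite z mulr0 mulr_ge0.
have [z|nz'] := eqVneq (p (i + j.+1 + s)%N) 0; first by rewrite z mul0r mulr_ge0.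
have pj : 0 < p (i + j)%N by apply: (pos i _ (i + j.+1 + s)%N) => //; lia.
rewrite -(ler_pM2r pj) addnS addSn.
apply: (@le_trans _ _ (p (i + j + s)%N * p i * p (i + j).+1)).
  by rewrite mulrAC [leRHS]mulrAC ler_wpM2r ?step1.
by rewrite [leRHS]mulrAC ler_wpM2r.
Qed.

Lemma lr_up_log_concave p :
  interval_support p -> lr_up p p -> log_concave p.
Proof.
move=> ip l; split=> // i; rewrite mulrC expr2.
by have := l i 1%N 1%N; rewrite !addn1.
Qed.

Lemma lr_up_trunc n p q :
  (forall i, 0 <= p i) -> (forall i, 0 <= q i) -> lr_up p q ->
  lr_up (nth 0 (\poly_(k < n) p k)) (nth 0 (\poly_(k < n) q k)).
Proof.
move=> p0 q0 l i j s; rewrite !coef_poly.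
have [lt|_] := ltnP (i + j + s)%N n; last first.
  by rewrite mul0r mulr_ge0 //; case: ifP.
have -> : (i < n)%N by lia.
have -> : (i + s < n)%N by lia.
have -> : (i + j < n)%N by lia.
exact: l.
Qed.

Lemma prod_poly_ge0 (I : finType) (P : I -> {poly R}) :
  (forall i k, 0 <= (P i)`_k) -> forall k, 0 <= (\prod_i P i)`_k.
Proof.
move=> P0; apply: (big_rec (fun Q : {poly R} => forall k, 0 <= Q`_k)) =>
  [k|i Q _ Q0 k]; first by rewrite coef1 ler0n.
by rewrite coefM sumr_ge0 // => a _; rewrite mulr_ge0.
Qed.

Lemma lr_up_prod (I : finType) (P Q : I -> {poly R}) :
  (forall i k, 0 <= (P i)`_k) -> (forall i k, 0 <= (Q i)`_k) ->
  (forall i, lr_up (nth 0 (P i)) (nth 0 (Q i))) ->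
  lr_up (nth 0 (\prod_i P i)) (nth 0 (\prod_i Q i)).
Proof.
move=> P0 Q0 l.
suff [] : [/\ forall k, 0 <= (\prod_i P i)`_k, forall k, 0 <= (\prod_i Q i)`_k
  & lr_up (nth 0 (\prod_i P i)) (nth 0 (\prod_i Q i))] by [].
apply: (big_ind2 (fun A B : {poly R} => [/\ forall k, 0 <= A`_k,
  forall k, 0 <= B`_k & lr_up (nth 0 A) (nth 0 B)])) => //.
- split=> [k|k|i j s]; rewrite !coef1 ?ler0n //.
  by rewrite -!natrM ler_nat; case: i; case: j; case: s.
- move=> A1 B1 A2 B2 [A10 B10 l1] [A20 B20 l2]; split=> [k|k|].
  + by rewrite coefM sumr_ge0 // => a _; rewrite mulr_ge0.
  + by rewrite coefM sumr_ge0 // => a _; rewrite mulr_ge0.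
  + exact: lr_up_mul.
Qed.

End LrUp.

(** * The law of the total of the inputs *)

Section Operators.
Variables (R : realType) (S : finType).
Implicit Types m : S -> nat -> R.

(** The coefficient of ['X^k] is the mass of the total at [k] for [k <= b] only:
    beyond [b] the truncation of the inputs loses terms. *)
Definition gen_fun (b : nat) m : {poly R} := \prod_i \poly_(k < b.+1) m i k.

Lemma sum_gen_fun b m n (phi : nat -> R) :
  \sum_(y : {ffun S -> 'I_b.+1} | (\sum_i y i <= n)%N)
     phi (\sum_i y i)%N * \prod_i m i (y i)
  = \sum_(k < n.+1) phi k * (gen_fun b m)`_k.
Proof.
have -> : gen_fun b m = \sum_(y : {ffun S -> 'I_b.+1})
    (\prod_i m i (y i)) *: 'X^(\sum_i y i).
  rewrite /gen_fun (eq_bigr (fun i => \sum_(k < b.+1) m i k *: 'X^k)).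
    rewrite bigA_distr_bigA; apply: eq_bigr => y _.
    by rewrite scaler_prod -[X in _ *: 'X^X]big_enum -expr_sum big_enum.
  by move=> i _; rewrite poly_def.
rewrite (eq_bigr (fun k : 'I_n.+1 => \sum_(y : {ffun S -> 'I_b.+1})
   if k == (\sum_i y i)%N :> nat then phi k * \prod_i m i (y i) else 0)); last first.
  move=> k _; rewrite coef_sum mulr_sumr; apply: eq_bigr => y _.
  by rewrite coefZ coefXn; case: eqP => _; rewrite ?mulr1 ?mulr0.
rewrite exchange_big /= [LHS]big_mkcond; apply: eq_bigr => y _.
move: (\sum_i y i)%N (\prod_i m i (y i)) => t w; case: leqP => tn; last first.
  by rewrite big1 // => k _; case: eqP => // kt; have := ltn_ord k; lia.
rewrite (bigD1 (Ordinal (tn : (t < n.+1)%N))) //= eqxx big1 ?addr0 // => k.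
by rewrite -val_eqE /= => /negPf ->.
Qed.

(** The truncated constant series turns coefficients into cumulative sums. *)
Lemma constrained_sumE m b x :
  constrained_sum m b x =
  if (x <= b)%N then (\poly_(k < b.+1) 1 * gen_fun b m)`_(b - x) else 0.
Proof.
case: leqP => xb; last by rewrite /constrained_sum big1 // => y; lia.
rewrite coefMr.
rewrite [RHS](eq_bigr (fun k : 'I__ => 1 * (gen_fun b m)`_k)); last first.
  by move=> k _; rewrite coef_poly ifT //; lia.
rewrite -(sum_gen_fun b m (b - x) (fun=> 1)).
apply: eq_big => [y|y _]; last by rewrite mul1r.
by move: (\sum_i y i)%N => t; lia.
Qed.

Lemma D_opE m b :
  D_op b m = (\sum_(k < b.+1) k%:R * (gen_fun b m)`_k)
               / (\sum_(k < b.+1) (gen_fun b m)`_k).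
Proof.
rewrite /D_op (sum_gen_fun b m b (fun k => k%:R)); congr (_ / _).
transitivity (\sum_(k < b.+1) 1 * (gen_fun b m)`_k).
  by rewrite -(sum_gen_fun b m b (fun=> 1)); apply: eq_bigr => y _; rewrite mul1r.
by apply: eq_bigr => k _; rewrite mul1r.
Qed.

Lemma gen_fun_ge0 b m :
  (forall i k, 0 <= m i k) -> forall k, 0 <= (gen_fun b m)`_k.
Proof.
by move=> m0; apply: prod_poly_ge0 => i k; rewrite coef_poly; case: ifP.
Qed.

Lemma gen_fun_lr_up b m1 m2 :
  (forall i k, 0 <= m1 i k) -> (forall i k, 0 <= m2 i k) ->
  (forall i, lr_up (m1 i) (m2 i)) ->
  lr_up (nth 0 (gen_fun b m1)) (nth 0 (gen_fun b m2)).
Proof.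
move=> m10 m20 l; apply: lr_up_prod => i.
- by move=> k; rewrite coef_poly; case: ifP.
- by move=> k; rewrite coef_poly; case: ifP.
- exact: lr_up_trunc.
Qed.

Lemma coef0_gen_fun b m : (gen_fun b m)`_0 = \prod_i m i 0%N.
Proof. by rewrite coef0_prod; apply: eq_bigr => i _; rewrite coef_poly. Qed.

Lemma constrained_sum_ge0 b m x :
  (forall i k, 0 <= m i k) -> 0 <= constrained_sum m b x.
Proof. by move=> m0; apply: sumr_ge0 => y _; apply: prodr_ge0. Qed.

(** The direction is reversed because the constrained sum at [x] is a cumulative
    sum evaluated at [b - x]. *)
Lemma constrained_sum_lr_up b m1 m2 :
  (forall i k, 0 <= m1 i k) -> (forall i k, 0 <= m2 i k) ->
  (forall i, lr_up (m1 i) (m2 i)) ->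
  lr_up (constrained_sum m2 b) (constrained_sum m1 b).
Proof.
move=> m10 m20 l.
pose E : {poly R} := \poly_(k < b.+1) 1.
have E0 k : 0 <= E`_k by rewrite coef_poly; case: ifP.
have lF : lr_up (nth 0 (E * gen_fun b m1)) (nth 0 (E * gen_fun b m2)).
  apply: lr_up_mul => //; try exact: gen_fun_ge0; last exact: gen_fun_lr_up.
  by apply: lr_up_trunc => // i j s.
move=> i j s.
have [ijsb|h] := leqP (i + j + s) b; last first.
  rewrite constrained_sumE leqNgt h mul0r.
  by rewrite mulr_ge0 // constrained_sum_ge0.
rewrite !constrained_sumE ijsb.
have -> : (i <= b)%N by lia.
have -> : (i + s <= b)%N by lia.
have -> : (i + j <= b)%N by lia.
have := lF (b - (i + j + s))%N j s.
have -> : (b - (i + j + s) + j + s = b - i)%N by lia.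
have -> : (b - (i + j + s) + j = b - (i + s))%N by lia.
have -> : (b - (i + j + s) + s = b - (i + j))%N by lia.
by rewrite mulrC [X in _ <= X -> _]mulrC.
Qed.

Lemma constrained_sum_gt0 b m x :
  (forall i k, 0 <= m i k) -> (forall i, m i 0%N != 0) ->
  (0 < constrained_sum m b x) = (x <= b)%N.
Proof.
move=> m0 mn0; case: leqP => xb; last first.
  by rewrite constrained_sumE leqNgt xb ltxx.
rewrite /constrained_sum (bigD1 [ffun=> ord0]) /=; last first.
  by rewrite big1 // => i _; rewrite ffunE.
(* The all-zero configuration already has positive weight. *)
rewrite ltr_wpDr //; first by apply: sumr_ge0 => y _; apply: prodr_ge0.
by apply: prodr_gt0 => i _; rewrite ffunE lt_neqAle eq_sym mn0 m0.
Qed.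

(** * The outgoing message *)

Lemma R_op_denom_gt0 (lam : R) b c m : 0 < lam ->
  (forall i k, 0 <= m i k) -> (forall i, m i 0%N != 0) ->
  0 < \sum_(t < c.+1) lam ^+ t * constrained_sum m b t.
Proof.
move=> lam0 m0 mn0; rewrite big_ord_recl ltr_wpDr //.
  apply: sumr_ge0 => t _; rewrite mulr_ge0 ?exprn_ge0 ?(ltW lam0) //.
  exact: constrained_sum_ge0.
by rewrite expr0 mul1r constrained_sum_gt0.
Qed.

Lemma R_op_ge0 (lam : R) b c m x : 0 < lam ->
  (forall i k, 0 <= m i k) -> 0 <= R_op lam b c m x.
Proof.
move=> /ltW lam0 m0; rewrite divr_ge0 ?mulr_ge0 ?exprn_ge0 //.
  exact: constrained_sum_ge0.
apply: sumr_ge0 => t _; rewrite mulr_ge0 ?exprn_ge0 //.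
exact: constrained_sum_ge0.
Qed.

Lemma R_op_neq0 (lam : R) b c m x : 0 < lam ->
  (forall i k, 0 <= m i k) -> (forall i, m i 0%N != 0) ->
  (R_op lam b c m x != 0) = (x <= c)%N && (x <= b)%N.
Proof.
move=> lam0 m0 mn0; rewrite /R_op !mulf_eq0 invr_eq0 !negb_or.
rewrite (gt_eqF (R_op_denom_gt0 b c lam0 m0 mn0)) andbT.
rewrite (expf_neq0 x (lt0r_neq0 lam0)) pnatr_eq0 eqb0 negbK.
rewrite -(constrained_sum_gt0 b x m0 mn0) lt_neqAle eq_sym.
by rewrite constrained_sum_ge0 ?andbT.
Qed.

Lemma Ptilde_R_op (lam : R) b c m : 0 < lam ->
  (forall i k, 0 <= m i k) -> (forall i, m i 0%N != 0) ->
  Ptilde (R_op lam b c m).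
Proof.
move=> lam0 m0 mn0; split; last by rewrite R_op_neq0.
- split=> [x|]; first exact: R_op_ge0.
  exists c.+1; split=> [i ci|].
    by rewrite /R_op leqNgt ci mulr0 !mul0r.
  rewrite -mulr_suml -[RHS](divff (lt0r_neq0 (R_op_denom_gt0 b c lam0 m0 mn0))).
  by congr (_ / _); apply: eq_bigr => t _; rewrite -ltnS ltn_ord mulr1.
- by move=> i k j; rewrite !R_op_neq0 //; lia.
Qed.

Lemma R_op_lr_up (lam : R) b c m1 m2 : 0 < lam ->
  (forall i k, 0 <= m1 i k) -> (forall i k, 0 <= m2 i k) ->
  (forall i, lr_up (m1 i) (m2 i)) ->
  lr_up (R_op lam b c m2) (R_op lam b c m1).
Proof.
move=> lam0 m10 m20 l i j s.
have [ijs|lt] := leqP (i + j + s) c; last first.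
  by rewrite [X in X * _ <= _]/R_op leqNgt lt mulr0 !mul0r mulr_ge0 ?R_op_ge0.
rewrite /R_op ijs.
have -> : (i <= c)%N by lia.
have -> : (i + s <= c)%N by lia.
have -> : (i + j <= c)%N by lia.
rewrite !mulr1 !mulf_div.
rewrite ler_wpM2r //.
  rewrite invr_ge0 mulr_ge0 //; apply: sumr_ge0 => t _;
  by rewrite mulr_ge0 ?exprn_ge0 ?constrained_sum_ge0 ?(ltW lam0).
rewrite mulrACA [leRHS]mulrACA -!exprD.
have -> : (i + s + (i + j) = i + j + s + i)%N by lia.
by rewrite ler_wpM2l ?exprn_ge0 ?(ltW lam0) //; apply: constrained_sum_lr_up.
Qed.

(** * The conditional mean of the total *)

Lemma D_op_denom_gt0 b m :
  (forall i k, 0 <= m i k) -> (forall i, m i 0%N != 0) ->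
  0 < \sum_(k < b.+1) (gen_fun b m)`_k.
Proof.
move=> m0 mn0; rewrite big_ord_recl ltr_wpDr //.
  by apply: sumr_ge0 => k _; apply: gen_fun_ge0.
rewrite coef0_gen_fun; apply: prodr_gt0 => i _.
by rewrite lt_neqAle eq_sym mn0 m0.
Qed.

Lemma D_op_ge0 b m : (forall i k, 0 <= m i k) -> 0 <= D_op b m.
Proof.
move=> m0; rewrite D_opE divr_ge0 //; apply: sumr_ge0 => k _.
  by rewrite mulr_ge0 ?gen_fun_ge0.
exact: gen_fun_ge0.
Qed.

Section DOp.
Variables (b : nat) (m1 m2 : S -> nat -> R).
Hypotheses (m1_ge0 : forall i k, 0 <= m1 i k) (m1_0 : forall i, m1 i 0%N != 0).
Hypotheses (m2_ge0 : forall i k, 0 <= m2 i k) (m2_0 : forall i, m2 i 0%N != 0).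
Hypothesis m12 : forall i, lr_up (m1 i) (m2 i).

Let P := gen_fun b m1.
Let Q := gen_fun b m2.

Let cross_le x y : (y <= x)%N -> P`_x * Q`_y <= P`_y * Q`_x.
Proof.
move=> yx; have := @gen_fun_lr_up b _ _ m1_ge0 m2_ge0 m12 y (x - y)%N 0%N.
by rewrite !addn0 subnKC.
Qed.

(** Cross-multiplying the two quotients leads to sums over index pairs of the
    shape compared by [swap_le] and [swap_lt]. *)
Let D_op_cross :
  let S1 := \sum_(k < b.+1) \sum_(l < b.+1) P`_k * Q`_l * k%:R in
  let S2 := \sum_(k < b.+1) \sum_(l < b.+1) P`_k * Q`_l * l%:R in
  ((D_op b m1 <= D_op b m2) = (S1 <= S2)) *
  ((D_op b m1 < D_op b m2) = (S1 < S2)).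
Proof.
move=> S1 S2.
have S1E : (\sum_(k < b.+1) k%:R * P`_k) * (\sum_(k < b.+1) Q`_k) = S1.
  rewrite big_distrlr; apply: eq_bigr => k _; apply: eq_bigr => l _ /=.
  by rewrite [k%:R * _]mulrC mulrAC.
have S2E : (\sum_(k < b.+1) k%:R * Q`_k) * (\sum_(k < b.+1) P`_k) = S2.
  rewrite mulrC big_distrlr; apply: eq_bigr => k _; apply: eq_bigr => l _ /=.
  by rewrite [l%:R * _]mulrC mulrA.
rewrite !D_opE -/P -/Q -S1E -S2E.
have P0 := D_op_denom_gt0 b m1_ge0 m1_0; have Q0 := D_op_denom_gt0 b m2_ge0 m2_0.
by split; [rewrite ler_pdivrMr // mulrAC ler_pdivlMr
          | rewrite ltr_pdivrMr // mulrAC ltr_pdivlMr].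
Qed.

Lemma D_op_le : D_op b m1 <= D_op b m2.
Proof.
rewrite D_op_cross.
apply: (@swap_le R b.+1 (fun k l => P`_k * Q`_l) (fun k _ => k%:R)) => // x y.
by rewrite ler_nat.
Qed.

(** The mirror pair [(k, 0)], [(0, k)] alone makes the gap positive. *)
Lemma D_op_lt k : (k <= b)%N ->
  (gen_fun b m1)`_k * (gen_fun b m2)`_0 != (gen_fun b m1)`_0 * (gen_fun b m2)`_k ->
  D_op b m1 < D_op b m2.
Proof.
rewrite -/P -/Q => kb ne; rewrite D_op_cross.
have k0 : k != 0%N by apply: contraNneq ne => ->.
apply: (@swap_lt R b.+1 (fun k l => P`_k * Q`_l) (fun k _ => k%:R)
          (Ordinal (kb : (k < b.+1)%N)) ord0) => // [x y||] /=.
- by rewrite ler_nat.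
- by rewrite eq_sym.
- by rewrite pnatr_eq0.
Qed.

End DOp.

(** [W] is invertible as a power series over the field of fractions. *)
Lemma coef_mul_eq0 (A : idomainType) (n : nat) (U W : {poly A}) : W`_0 != 0 ->
  (forall k, (k < n)%N -> (U * W)`_k = 0) -> forall k, (k < n)%N -> U`_k = 0.
Proof.
move=> W0 UW; elim/ltn_ind => k IH kn.
have := UW k kn; rewrite coefM big_ord_recr /= subnn big1 => [|a _].
  by rewrite add0r => /eqP; rewrite mulf_eq0 (negPf W0) orbF => /eqP.
by rewrite IH ?mul0r // (ltn_trans (ltn_ord a)).
Qed.

Lemma cond_le_scale (b : nat) (p q : nat -> R) (u w : R) :
  u != 0 -> w != 0 -> (forall x, (x <= b)%N -> p x * u = q x * w) ->
  cond_le b p =1 cond_le b q.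
Proof.
move=> u0 w0 pq x; rewrite /cond_le.
have pE y : (y <= b)%N -> p y = w / u * q y.
  by move=> yb; rewrite mulrAC [w * _]mulrC -pq // mulfK.
rewrite (eq_bigr (fun t : 'I_b.+1 => w / u * q t)) -?mulr_sumr; last first.
  by move=> t _; rewrite pE // -ltnS.
case: leqP => xb; last by rewrite !mul0r.
by rewrite !mul1r pE // -mulf_div divff ?mul1r // mulf_neq0 ?invr_neq0.
Qed.

Lemma D_op_lt_log_concave b m1 m2 i0 x :
  (forall i k, 0 <= m1 i k) -> (forall i, m1 i 0%N != 0) ->
  (forall i k, 0 <= m2 i k) -> (forall i, m2 i 0%N != 0) ->
  (forall i, lr_up (m1 i) (m2 i)) ->
  (forall i, log_concave (m1 i)) -> (forall i, log_concave (m2 i)) ->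
  cond_le b (m1 i0) x <> cond_le b (m2 i0) x ->
  D_op b m1 < D_op b m2.
Proof.
move=> m1_ge0 m1_0 m2_ge0 m2_0 l lc1 lc2 ne.
(* [m] is the mixed family; passing from [m1] to [m] is the strict step. *)
pose m i := if i == i0 then m2 i else m1 i.
have m_ge0 i k : 0 <= m i k by rewrite /m; case: ifP.
have m_0 i : m i 0%N != 0 by rewrite /m; case: ifP.
have l1 i : lr_up (m1 i) (m i).
  by rewrite /m; case: eqP => // _; apply: lr_up_refl.
have l2 i : lr_up (m i) (m2 i).
  by rewrite /m; case: eqP => // _; apply: lr_up_refl.
apply: lt_le_trans (D_op_le b m_ge0 m_0 m2_ge0 m2_0 l2).
pose W := \prod_(i | i != i0) \poly_(k < b.+1) m1 i k.
pose T1 := \poly_(k < b.+1) m1 i0 k; pose T2 := \poly_(k < b.+1) m2 i0 k.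
have P1 : gen_fun b m1 = T1 * W by rewrite /gen_fun (bigD1 i0).
have P2 : gen_fun b m = T2 * W.
  rewrite /gen_fun (bigD1 i0) //= /m eqxx; congr (_ * _).
  by apply: eq_bigr => i /negPf ->.
have W0 : W`_0 != 0.
  rewrite coef0_prod; apply/prodf_neq0 => i _.
  by rewrite coef_poly; apply: m1_0.
set P := gen_fun b m1 in P1; set Q := gen_fun b m in P2.
have P0 : P`_0 != 0 by rewrite coef0_gen_fun; apply/prodf_neq0.
have Q0 : Q`_0 != 0 by rewrite coef0_gen_fun; apply/prodf_neq0.
have [/existsP [k nek]|/existsPn eqk] :=
  boolP [exists k : 'I_b.+1, P`_k * Q`_0 != P`_0 * Q`_k].
  exact: (D_op_lt m1_ge0 m1_0 m_ge0 m_0 l1 (ltn_ord k : (k <= b)%N) nek).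
(* Equality of all cross products cancels the common factor [W], leaving
   proportional inputs at [i0]. *)
case: ne; apply: (cond_le_scale Q0 P0) => y yb.
have UW k : (k < b.+1)%N -> ((Q`_0 *: T1 - P`_0 *: T2) * W)`_k = 0.
  move=> kb; rewrite mulrBl -!scalerAl -P1 -P2 coefB !coefZ.
  have /negPn/eqP := eqk (Ordinal kb).
  by rewrite /= [P`_k * _]mulrC => ->; rewrite subrr.
have := coef_mul_eq0 W0 UW (yb : (y < b.+1)%N).
rewrite coefB !coefZ !coef_poly ltnS yb => /subr0_eq.
by rewrite mulrC [RHS]mulrC.
Qed.

End Operators.

Theorem proposition2 (R : realType) (G : graph)
    (b : G -> nat) (c : G -> G -> nat) (c_sym : forall u w, c u w = c w u)
    (v : G) :
  (forall (u : G) (lam : R), u \in nbr v -> 0 < lam ->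
    [/\ forall m : seq_sub (prev_edges (v, u)) -> nat -> R,
          (forall i, Ptilde (m i)) -> Ptilde (R_edge b c lam m),
        forall m1 m2 : seq_sub (prev_edges (v, u)) -> nat -> R,
          (forall i, Ptilde (m1 i)) -> (forall i, Ptilde (m2 i)) ->
          (forall i, lr_up (m1 i) (m2 i)) ->
          lr_up (R_edge b c lam m2) (R_edge b c lam m1)
      & forall m : seq_sub (prev_edges (v, u)) -> nat -> R,
          (forall i, Ptilde (m i)) -> (forall i, log_concave (m i)) ->
          log_concave (R_edge b c lam m)]) /\
  [/\ forall m : seq_sub (in_edges v) -> nat -> R,
        (forall i, Ptilde (m i)) -> 0 <= D_vertex b m,
      forall m1 m2 : seq_sub (in_edges v) -> nat -> R,
        (forall i, Ptilde (m1 i)) -> (forall i, Ptilde (m2 i)) ->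
        (forall i, lr_up (m1 i) (m2 i)) ->
        D_vertex b m1 <= D_vertex b m2
    & forall m1 m2 : seq_sub (in_edges v) -> nat -> R,
        (forall i, Ptilde (m1 i)) -> (forall i, Ptilde (m2 i)) ->
        (forall i, lr_up (m1 i) (m2 i)) ->
        (forall i, log_concave (m1 i) /\ m1 i 0%N != 0) ->
        (forall i, log_concave (m2 i) /\ m2 i 0%N != 0) ->
        (exists i x, cond_le (b v) (m1 i) x <> cond_le (b v) (m2 i) x) ->
        D_vertex b m1 < D_vertex b m2].
Proof.
have ge0 (I : Type) (m : I -> nat -> R) :
    (forall i, Ptilde (m i)) -> forall i k, 0 <= m i k.
  by move=> pt i; have [[]] := pt i.
have n0 (I : Type) (m : I -> nat -> R) :
    (forall i, Ptilde (m i)) -> forall i, m i 0%N != 0.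
  by move=> pt i; have [] := pt i.
split=> [u lam _ lam0|]; split.
- by move=> m pt; apply: Ptilde_R_op => //; [exact: ge0 | exact: n0].
- by move=> m1 m2 p1 p2 l; apply: R_op_lr_up => //; exact: ge0.
(* A log-concave family is below itself, hence so is its image. *)
- move=> m pt lc; apply: lr_up_log_concave.
    by have [] := Ptilde_R_op (b v) (c v u) lam0 (ge0 _ _ pt) (n0 _ _ pt).
  by apply: R_op_lr_up => // [||i]; [exact: ge0 | exact: ge0 |];
     apply: lr_up_refl => //; exact: ge0.
- by move=> m pt; apply: D_op_ge0; exact: ge0.
- by move=> m1 m2 p1 p2 l; apply: D_op_le => //; (exact: ge0 || exact: n0).
- move=> m1 m2 p1 p2 l lc1 lc2 [i0 [x ne]].
  apply: (D_op_lt_log_concave _ _ _ _ l _ _ ne); try exact: ge0; try exact: n0.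
    by move=> i; have [] := lc1 i.
  by move=> i; have [] := lc2 i.
Qed.
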